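(* Let $G$ be an abelian group, $\mathbb{F}$ a field, and $\mathcal{R}$ a $G$-graded associative $\mathbb{F}$-algebra, with grading denoted $\Gamma$, which is graded-simple and satisfies the descending chain condition on graded left ideals. Write $\mathcal{R}\cong\operatorname{End}_{\mathcal{D}}(\mathcal{V})$ (as $G$-graded algebras), where $\mathcal{D}$ is a $G$-graded associative $\mathbb{F}$-algebra which is a graded-division algebra, with grading $\Gamma_0$ and support $T$, and $\mathcal{V}$ is a nonzero $G$-graded right $\mathcal{D}$-module of finite dimension over $\mathcal{D}$. Let $g_1T,\dots,g_sT$ be the distinct supports (cosets in $G/T$) of the isotypic components of $\mathcal{V}$, and let $k_1,\dots,k_s$ be the $\mathcal{D}$-dimensions of those components. Then the grading $\Gamma$ on $\mathcal{R}$ is fine in the class of abelian group gradings if and only if both of the following hold: (1) (fine condition) $k_1=\dots=k_s=1$, and $g_ig_j^{-1}\not\equiv g_hg_\ell^{-1}\pmod T$ for all indices $i,j,h,\ell\in\{1,\dots,s\}$ with $i\neq j$ and $(i,j)\neq(h,\ell)$; (2) the grading $\Gamma_0$ on $\mathcal{D}$ is fine in the class of abelian group gradings.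
   Context: A graded algebra is graded-simple if its product is nonzero and it has no graded two-sided ideals other than $0$ and itself. A graded-division algebra is a (nonzero) unital graded associative algebra in which every nonzero homogeneous element is invertible; its support $T=\{g\in G\mid\mathcal{D}_g\neq 0\}$ is a subgroup of $G$. A $G$-graded right $\mathcal{D}$-module is $\mathcal{V}=\bigoplus_{g\in G}\mathcal{V}_g$ with $\mathcal{V}_g\mathcal{D}_h\subseteq\mathcal{V}_{gh}$; it is free with a homogeneous $\mathcal{D}$-basis, and its $\mathcal{D}$-dimension is the number of elements of such a basis. $\operatorname{End}_{\mathcal{D}}(\mathcal{V})$ is graded by: $r$ has degree $g$ if $r\mathcal{V}_h\subseteq\mathcal{V}_{gh}$ for all $h\in G$. The isotypic components of $\mathcal{V}$ are the nonzero subspaces among $\bigoplus_{h\in gT}\mathcal{V}_h$, $gT\in G/T$; each is a graded submodule whose support is the coset $gT$. It is a known fact that every $\mathcal{R}$ as in the statement is of the form $\operatorname{End}_{\mathcal{D}}(\mathcal{V})$. Given gradings $\Gamma:\mathcal{R}=\bigoplus_{g\in G}\mathcal{R}_g$ and $\Gamma':\mathcal{R}=\bigoplus_{h\in H}\mathcal{R}'_h$ on the same algebra, $\Gamma'$ is a refinement of $\Gamma$ if every nonzero $\mathcal{R}'_h$ is contained in some $\mathcal{R}_g$; the refinement is proper if some of these containments is strict. A grading is fine in the class of abelian group gradings if it admits no proper refinement which is a grading by an abelian group. *)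

(* Defs.v *)
From HB Require Import structures.
From mathcomp Require Import all_boot all_order all_algebra.
From mathcomp Require Import boolp classical_sets.

Set Implicit Arguments.
Unset Strict Implicit.
Unset Printing Implicit Defensive.

Import GRing.Theory.

Local Open Scope classical_set_scope.
Local Open Scope ring_scope.

(* Abelian grading groups are [zmodType]s, hence written additively:
   gh, g h^-1 and e become g + h, g - h and 0. *)

Definition sum_over (M : zmodType) (I : eqType) (P : set I) (C : I -> set M) :
    set M :=
  [set x | exists (s : seq I) (f : I -> M),
    (forall i, i \in s -> P i /\ C i (f i)) /\ x = \sum_(i <- s) f i].

Record direct_sum (M : zmodType) (I : eqType) (C : I -> set M) : Prop := {
  direct_sum_zmod : forall i,
    C i 0 /\ (forall x y, C i x -> C i y -> C i (x - y));
  direct_sum_full : sum_over [set: I] C = [set: M];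
  direct_sum_indep : forall (s : seq I) (f : I -> M), uniq s ->
    (forall i, i \in s -> C i (f i)) -> \sum_(i <- s) f i = 0 ->
    forall i, i \in s -> f i = 0
}.

Definition gsupp (M : zmodType) (I : Type) (C : I -> set M) : set I :=
  [set i | exists2 x, C i x & x != 0].

(* Algebras need not be unital, whereas [algType] is unital and nonzero; a
   general associative algebra is thus an [lmodType] with a product [mul].
   A unital algebra [A : algType F] is viewed this way through [*%R]. *)
Record assoc_algebra (F : fieldType) (A : lmodType F) (mul : A -> A -> A) :
    Prop := {
  assoc_algebra_linl : forall y, linear (mul^~ y);
  assoc_algebra_linr : forall x, linear (mul x);
  assoc_algebra_assoc : associative mul
}.

Record grading (F : fieldType) (A : lmodType F) (mul : A -> A -> A)
    (G : zmodType) (C : G -> set A) : Prop := {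
  grading_direct_sum : direct_sum C;
  grading_scale : forall g (a : F) x, C g x -> C g (a *: x);
  grading_mul : forall g h x y, C g x -> C h y -> C (g + h) (mul x y)
}.

Section Fine.
Variables (F : fieldType) (A : lmodType F) (mul : A -> A -> A).

Definition refinement (G H : zmodType) (C : G -> set A) (C' : H -> set A) :
    Prop :=
  forall h, gsupp C' h -> exists g, C' h `<=` C g.

Definition proper_refinement (G H : zmodType) (C : G -> set A)
    (C' : H -> set A) : Prop :=
  refinement C C' /\ exists h g, gsupp C' h /\ C' h `<` C g.

Definition fine (G : zmodType) (C : G -> set A) : Prop :=
  forall (H : zmodType) (C' : H -> set A),
    grading mul C' -> ~ proper_refinement C C'.

End Fine.

Section GradedIdeals.
Variables (F : fieldType) (A : lmodType F) (mul : A -> A -> A).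
Variables (G : zmodType) (C : G -> set A).

Record graded_subspace (W : set A) : Prop := {
  graded_subspace_linear :
    W 0 /\ (forall (a : F) x y, W x -> W y -> W (a *: x + y));
  graded_subspace_hom : W `<=` sum_over [set: G] (fun g => C g `&` W)
}.

Definition graded_left_ideal (W : set A) : Prop :=
  graded_subspace W /\ forall a x, W x -> W (mul a x).

Definition graded_ideal (W : set A) : Prop :=
  graded_subspace W /\ forall a x, W x -> W (mul a x) /\ W (mul x a).

Definition graded_simple : Prop :=
  (exists x y, mul x y != 0) /\
  forall W, graded_ideal W -> W = [set 0] \/ W = [set: A].

Definition graded_left_dcc : Prop :=
  forall W : nat -> set A,
    (forall n, graded_left_ideal (W n)) -> (forall n, W n.+1 `<=` W n) ->
    exists N, forall n, (N <= n)%N -> W n = W N.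

End GradedIdeals.

(* [1 != 0] is part of [algType]. *)
Record graded_division (F : fieldType) (D : algType F) (G : zmodType)
    (D_ : G -> set D) : Prop := {
  graded_division_grading : grading *%R D_;
  graded_division_inv : forall g d, D_ g d -> d != 0 ->
    exists e, d * e = 1 /\ e * d = 1
}.

(* A right D-module is a left module over the converse ring [D^c]: for
   [d : D^c], [d *: v] stands for the right action v d.  The base field acts
   through [a%:A], the image of [a] in D. *)

Section GradedModules.
Variables (F : fieldType) (D : algType F) (G : zmodType) (D_ : G -> set D).
Variables (V : lmodType D^c) (V_ : G -> set V).

(* The V_g are F-subspaces since F 1 is contained in the identity component
   of D. *)
Record graded_module : Prop := {
  graded_module_direct_sum : direct_sum V_;
  graded_module_scale : forall g h (v : V) (d : D),
    V_ g v -> D_ h d -> V_ (g + h) ((d : D^c) *: v)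
}.

Definition has_dim (W : set V) (n : nat) : Prop :=
  exists b : 'I_n -> V,
    [/\ forall i, exists g, V_ g (b i),
        W = [set v | exists c : 'I_n -> D^c, v = \sum_(i < n) c i *: b i]
      & forall c : 'I_n -> D^c,
          \sum_(i < n) c i *: b i = 0 -> forall i, c i = 0].

(* For T the support of D, [coset T g] is the coset gT. *)
Definition coset (T : set G) (g : G) : set G := [set h | T (h - g)].

Definition isotypic (g : G) : set V := sum_over (coset (gsupp D_) g) V_.

Definition isotypic_components : set (set V) :=
  [set W | (exists g, W = isotypic g) /\ exists2 v, W v & v != 0].

Definition graded_supp (W : set V) : set G := gsupp (fun h => V_ h `&` W).

Definition End_degree (g : G) (r : V -> V) : Prop :=
  forall h v, V_ h v -> V_ (g + h) (r v).

(* Elements of End_D(V) are compared as functions. *)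
Record graded_iso_End (R : lmodType F) (mul : R -> R -> R) (R_ : G -> set R)
    (phi : R -> {linear V -> V}) : Prop := {
  graded_iso_linear : forall (a : F) x y v,
    phi (a *: x + y) v = (a%:A : D^c) *: phi x v + phi y v;
  graded_iso_mul : forall x y v, phi (mul x y) v = phi x (phi y v);
  graded_iso_inj : forall x y, phi x =1 phi y -> x = y;
  graded_iso_surj : forall f : {linear V -> V}, exists x, phi x =1 f;
  graded_iso_degree : forall g x, R_ g x <-> End_degree g (phi x)
}.

End GradedModules.

Definition fine_condition (G : zmodType) (T : set G) (s : nat) (g : 'I_s -> G)
    (k : 'I_s -> nat) : Prop :=
  (forall i, k i = 1%N) /\
  forall i j h l : 'I_s, i <> j -> (i, j) <> (h, l) ->
    ~ T ((g i - g j) - (g h - g l)).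

(* Main.v *)
Require Import Defs.
From HB Require Import structures.
From mathcomp Require Import all_boot all_order all_algebra.
From mathcomp Require Import boolp classical_sets.

Set Implicit Arguments.
Unset Strict Implicit.
Unset Printing Implicit Defensive.

Import GRing.Theory.

Local Open Scope classical_set_scope.
Local Open Scope ring_scope.

(* A homogeneous basis of V, with b_p of degree w_p, identifies R with matrices
   over D, the degree of E_pq(d) being w_p - w_q + deg d.

   If Gamma is fine and D' is a grading by H refining that of D, then giving
   E_pq(d) the degree (deg d, e_p - e_q) in H x Z^I refines Gamma, so each
   component of this grading is one of Gamma.  Taking D' = Gamma_0 shows that
   the degrees w_p - w_q (p <> q) are separated modulo T, and taking any D'
   shows that Gamma_0 is fine.

   Conversely, when the degrees are separated, the blocks E_pq D with p <> q are
   sums of components of Gamma.  In an abelian grading C refining Gamma, the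
   products of homogeneous elements of E_pq D_0 and E_qp D_0 provide homogeneous
   elements E_pp(c) with c invertible, and these force the idempotents E_pp(1)
   into C_0.  So C restricts to the corners E_pp D = D, where it cannot properly
   refine Gamma_0; multiplication by homogeneous off-diagonal elements then
   carries a full component from one corner or block to the others. *)

Lemma subrBA (V : zmodType) (x y z : V) : x - (y - z) = x - y + z.
Proof. by rewrite opprB addrA addrAC. Qed.

Lemma subrBB (V : zmodType) (x y z : V) : (x - y) - (x - z) = z - y.
Proof. by rewrite opprB addrC addrA subrK. Qed.

Lemma subrACA (U : zmodType) (x y z t : U) : (x - y) - (z - t) = (x - z) - (y - t).
Proof. by rewrite !opprB addrACA [RHS]addrACA [- y + _]addrC. Qed.

(** * Components of a direct sum *)

Lemma sum_support (M : nmodType) (I : eqType) (s t : seq I) (f : I -> M) :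
  uniq s -> uniq t -> {subset s <= t} -> (forall i, i \notin s -> f i = 0) ->
  \sum_(i <- s) f i = \sum_(i <- t) f i.
Proof.
move=> us ut st fs; rewrite [RHS](bigID (mem s)) /= [X in _ + X]big1 ?addr0 //.
rewrite -[RHS]big_filter; apply: perm_big; apply: uniq_perm => //.
  by rewrite filter_uniq.
by move=> i; rewrite mem_filter; apply/idP/andP => [/[dup] /st|[]].
Qed.

Section SumOver.
Variables (M : zmodType) (I : eqType) (C : I -> set M).
Hypothesis C_zmod : forall i, C i 0 /\ (forall x y, C i x -> C i y -> C i (x - y)).

Lemma family0 i : C i 0. Proof. by case: (C_zmod i). Qed.

Lemma familyB i x y : C i x -> C i y -> C i (x - y).
Proof. by case: (C_zmod i) => _; apply. Qed.

Lemma familyD i x y : C i x -> C i y -> C i (x + y).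
Proof.
move=> Cx Cy; rewrite -[y]opprK; apply: familyB => //.
by rewrite -sub0r; apply: familyB => //; apply: family0.
Qed.

Lemma family_sum i (J : Type) (r : seq J) (P : pred J) (F : J -> M) :
  (forall j, P j -> C i (F j)) -> C i (\sum_(j <- r | P j) F j).
Proof.
move=> CF; elim/big_rec: _ => [|j x Pj Cx]; first exact: family0.
exact/familyD/Cx/CF.
Qed.

Lemma sum_over_finsupp (P : set I) x : sum_over P C x -> exists (s : seq I) (f : I -> M),
  [/\ uniq s, forall i, C i (f i), forall i, i \notin s -> f i = 0,
      forall i, i \in s -> P i & x = \sum_(i <- s) f i].
Proof.
move=> [s [f [sf ->]]].
(* Indices may repeat in [s], each occurrence contributing [f i]; collecting them gives the multiple
   [f i *+ count_mem i s], which vanishes off [s]. *)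
exists (undup s), (fun i => f i *+ count_mem i s); split.
- exact: undup_uniq.
- move=> i; have [si|nsi] := boolP (i \in s); last first.
    by rewrite (count_memPn nsi); apply: family0.
  elim: count => [|n IHn]; first exact: family0.
  by rewrite mulrS; apply: familyD => //; case: (sf i si).
- by move=> i; rewrite mem_undup => nsi; rewrite (count_memPn nsi).
- by move=> i; rewrite mem_undup => /sf[].
- rewrite -big_undup_iterop_count; apply: eq_bigr => i _.
  by rewrite Monoid.iteropE /= ; elim: (count_mem i s) => //= n ->; rewrite mulrS.
Qed.

Lemma sum_over1 (P : set I) i x : P i -> C i x -> sum_over P C x.
Proof.
move=> Pi Cx; exists [:: i], (fun=> x); split; last by rewrite big_seq1.
by move=> j; rewrite inE => /eqP->.
Qed.

Lemma sum_over0 (P : set I) : sum_over P C 0.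
Proof. by exists [::], (fun=> 0); split=> //; rewrite big_nil. Qed.

Lemma sum_overD (P : set I) x y :
  sum_over P C x -> sum_over P C y -> sum_over P C (x + y).
Proof.
move=> /sum_over_finsupp[s [f [us Cf sf sP ->]]].
move=> /sum_over_finsupp[r [h [ur Ch rh rP ->]]].
exists (undup (s ++ r)), (fun i => f i + h i); split.
  move=> i; rewrite mem_undup mem_cat => /orP si.
  by split; [case: si => [/sP|/rP]|apply: familyD].
rewrite big_split /=; congr (_ + _); apply: sum_support => //;
  by [apply: undup_uniq|move=> i ?; rewrite mem_undup mem_cat; apply/orP; auto].
Qed.

Lemma sum_over_sum (P : set I) (J : Type) (r : seq J) (Q : pred J) (F : J -> M) :
  (forall j, Q j -> sum_over P C (F j)) -> sum_over P C (\sum_(j <- r | Q j) F j).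
Proof.
move=> CF; elim/big_rec: _ => [|j x Qj Cx]; first exact: sum_over0.
exact/sum_overD/Cx/CF.
Qed.

End SumOver.

Section Component.
Variables (M : zmodType) (I : eqType) (C : I -> set M) (dC : direct_sum C).

Let C_zmod := direct_sum_zmod dC.

Lemma component_subproof x : exists f : I -> M, (forall i, C i (f i)) /\
  exists s, [/\ uniq s, forall i, i \notin s -> f i = 0 & x = \sum_(i <- s) f i].
Proof.
have : sum_over [set: I] C x by rewrite direct_sum_full.
move=> /(sum_over_finsupp C_zmod)[s [f [us Cf sf _ ->]]].
by exists f; split=> //; exists s.
Qed.

Definition component i x := sval (cid (component_subproof x)) i.

Lemma component_in i x : C i (component i x).
Proof. by rewrite /component; case: cid => f /= []. Qed.

Lemma componentP x : exists s, [/\ uniq s,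
  forall i, i \notin s -> component i x = 0 & x = \sum_(i <- s) component i x].
Proof. by rewrite /component; case: cid => f /= []. Qed.

Lemma component_uniq x (s : seq I) (f : I -> M) : uniq s ->
  (forall i, C i (f i)) -> (forall i, i \notin s -> f i = 0) ->
  x = \sum_(i <- s) f i -> forall i, component i x = f i.
Proof.
move=> us Cf sf xE; have [r [ur rh xE']] := componentP x => i.
set t := undup (s ++ r).
have [ti|nti] := boolP (i \in t); last first.
  rewrite mem_undup mem_cat negb_or in nti.
  by case/andP: nti => /sf-> /rh->.
apply/eqP; rewrite -subr_eq0; apply/eqP.
apply: (direct_sum_indep dC (s := t) (f := fun i => component i x - f i)) => //.
- exact: undup_uniq.
- by move=> j _; apply: (familyB C_zmod) => //; apply: component_in.
have xt : x = \sum_(i <- t) component i x.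
  rewrite {1}xE'; apply: sum_support => //; first exact: undup_uniq.
  by move=> j jr; rewrite mem_undup mem_cat jr orbT.
have ft : x = \sum_(i <- t) f i.
  rewrite {1}xE; apply: sum_support => //; first exact: undup_uniq.
  by move=> j js; rewrite mem_undup mem_cat js.
by rewrite sumrB -xt -ft subrr.
Qed.

Lemma component_id i x : C i x -> component i x = x.
Proof.
move=> Cx; rewrite (@component_uniq x [:: i] (fun j => if j == i then x else 0)).
- by rewrite eqxx.
- by [].
- by move=> j; case: eqP => [->|_] //; apply: (family0 C_zmod).
- by move=> j; rewrite inE => /negPf->.
- by rewrite big_seq1 eqxx.
Qed.

Lemma component_neq i j x : C j x -> i != j -> component i x = 0.
Proof.
move=> Cx ij; rewrite (@component_uniq x [:: j] (fun j' => if j' == j then x else 0)).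
- by rewrite (negPf ij).
- by [].
- by move=> k; case: eqP => [->|_] //; apply: (family0 C_zmod).
- by move=> k; rewrite inE => /negPf->.
- by rewrite big_seq1 eqxx.
Qed.

Lemma direct_sum_eq i j x : C i x -> C j x -> x != 0 -> i = j.
Proof.
move=> Ci Cj; apply: contraNeq => ij.
by rewrite -(component_id Ci) (component_neq Cj ij).
Qed.

Lemma component_neq0 x : x != 0 -> exists i, component i x != 0.
Proof.
move=> x0; apply: contrapT => /forallNP c0.
have [s [_ _ xE]] := componentP x; case/eqP: x0; rewrite xE big1 // => i _.
by apply/eqP/negP => /negP /c0.
Qed.

Lemma eq_component x y : (forall i, component i x = component i y) -> x = y.
Proof.
move=> xy; have [s [us sx ->]] := componentP x.
have [r [ur ry ->]] := componentP y.
rewrite (bigID (mem r)) [RHS](bigID (mem s)) /=; congr (_ + _).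
  rewrite -[LHS]big_filter -[RHS]big_filter.
  under eq_bigr do rewrite xy.
  apply: perm_big; apply: uniq_perm; rewrite ?filter_uniq // => i.
  by rewrite !mem_filter andbC.
by rewrite !big1 // => i; [move=> /sx; rewrite xy|move=> /ry; rewrite xy].
Qed.

End Component.

(** Injectivity of [d] keeps distinct components of [x] in distinct components of [f x]. Used for
    multiplication by a homogeneous element, where [d] is a translation, and for refinements, where
    [d] is the identity. *)
Lemma component_morph (M N : zmodType) (I J : eqType) (C : I -> set M)
    (C' : J -> set N) (dC : direct_sum C) (dC' : direct_sum C') (f : M -> N)
    (d : I -> J) : {morph f : x y / x + y} -> injective d ->
    (forall i x, C i x -> C' (d i) (f x)) ->
  forall i x, component dC' (d i) (f x) = f (component dC i x).
Proof.
move=> fD d_inj fC i x.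
have f0 : f 0 = 0 by apply: (addrI (f 0)); rewrite -fD !addr0.
have [s [us sx xE]] := componentP dC x.
have fs (r : seq I) : f (\sum_(j <- r) component dC j x) =
    \sum_(j <- r) f (component dC j x) by apply: big_morph.
(* The candidate decomposition of [f x]: transported along [d], and zero at indices outside the
   image of [d]. *)
pose h j := if pselect (exists i, j = d i) is left e then
  f (component dC (sval (cid e)) x) else 0.
have hd i' : h (d i') = f (component dC i' x).
  rewrite /h; case: pselect => [e|[]]; last by exists i'.
  by case: cid => i'' /= /d_inj->.
rewrite -hd; apply: (@component_uniq _ _ _ _ _ (map d s)).
- by rewrite map_inj_uniq.
- move=> j; rewrite /h; case: pselect => [e|_]; last first.
    exact: (family0 (direct_sum_zmod dC')).
  by case: cid => i' /= ->; exact: fC (component_in _ _ _).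
- move=> j; rewrite /h; case: pselect => [e|//].
  case: cid => i' /= ->; rewrite mem_map // => /sx->; exact: f0.
- by rewrite big_map {1}xE fs; apply: eq_bigr => j _; rewrite hd.
Qed.

Section ComponentAdd.
Variables (M : zmodType) (I : eqType) (C : I -> set M) (dC : direct_sum C).

Lemma componentD i : {morph component dC i : x y / x + y}.
Proof.
move=> x y.
have [s [us sx xE]] := componentP dC x; have [r [ur ry yE]] := componentP dC y.
pose t := undup (s ++ r).
apply: (@component_uniq _ _ _ dC _ t (fun i => component dC i x + component dC i y)).
- exact: undup_uniq.
- by move=> j; apply: (familyD (direct_sum_zmod dC)); apply: component_in.
- move=> j; rewrite mem_undup mem_cat negb_or => /andP[js jr].
  by rewrite sx // ry // addr0.
- rewrite big_split /= {1}xE {1}yE.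
  congr (_ + _); apply: sum_support => //; first exact: undup_uniq.
  + by move=> j js; rewrite mem_undup mem_cat js.
  + exact: undup_uniq.
  + by move=> j jr; rewrite mem_undup mem_cat jr orbT.
Qed.

Lemma component0 i : component dC i 0 = 0.
Proof. by apply: (addrI (component dC i 0)); rewrite -componentD !addr0. Qed.

Lemma component_sum i (J : Type) (r : seq J) (P : pred J) (F : J -> M) :
  component dC i (\sum_(j <- r | P j) F j) = \sum_(j <- r | P j) component dC i (F j).
Proof. exact: (big_morph _ (componentD i) (component0 i)). Qed.

Lemma component_notin (P : set I) i x : sum_over P C x -> ~ P i -> component dC i x = 0.
Proof.
move=> [s [f [sf ->]]] Pi; rewrite component_sum big_seq big1 // => j /sf[Pj Cj].
by apply: component_neq Cj _; apply: contra_notN Pi => /eqP->.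
Qed.

End ComponentAdd.

(** Independence comes from applying the additive maps [pr i] to a vanishing sum: each one isolates
    a single summand. *)
Lemma direct_sumI (M : zmodType) (I : eqType) (C : I -> set M) (pr : I -> M -> M) :
  (forall i, C i 0 /\ (forall x y, C i x -> C i y -> C i (x - y))) ->
  (forall x, sum_over [set: I] C x) ->
  (forall i, {morph pr i : x y / x + y}) ->
  (forall i x, C i x -> pr i x = x) ->
  (forall i j x, C j x -> i != j -> pr i x = 0) -> direct_sum C.
Proof.
move=> C_zmod C_full prD pr_id pr_neq; split=> //.
  by apply/seteqP; split=> x // _; apply: C_full.
move=> s f us sf f0 i si.
have pr0 : pr i 0 = 0 by apply: (addrI (pr i 0)); rewrite -prD !addr0.
rewrite -(pr_id _ _ (sf i si)) -pr0 -f0 (big_morph _ (prD i) pr0).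
rewrite (bigD1_seq i) //= big_seq_cond big1 ?addr0 // => j /andP[sj ji].
by apply: pr_neq (sf j sj) _; rewrite eq_sym.
Qed.

(** * Graded algebras *)

Section Grading.
Variables (F : fieldType) (A : lmodType F) (mul : A -> A -> A).
Hypotheses (mulDl : left_distributive mul +%R) (mulDr : right_distributive mul +%R).
Variables (G : zmodType) (C : G -> set A) (gC : grading mul C).

Let dC := grading_direct_sum gC.

Lemma component_mulr h k x y :
  C k y -> component dC (h + k) (mul x y) = mul (component dC h x) y.
Proof.
move=> Cy; apply: (component_morph dC dC (f := mul^~ y) (d := fun h => h + k)).
- by move=> u v; rewrite mulDl.
- exact: addIr.
- by move=> i u Cu; apply: grading_mul gC _ _ _ _ Cu Cy.
Qed.

Lemma component_mull h k x y :
  C k x -> component dC (k + h) (mul x y) = mul x (component dC h y).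
Proof.
move=> Cx; apply: (component_morph dC dC (f := mul x) (d := fun h => k + h)).
- by move=> u v; rewrite mulDr.
- exact: addrI.
- by move=> i u Cu; apply: grading_mul gC _ _ _ _ Cx Cu.
Qed.

End Grading.

(** Each nonzero component of [C'] lies in one component of [C], so the projection onto [C g] maps
    it into itself and hence commutes with the projections of [C']. *)
Lemma refinement_component (F : fieldType) (A : lmodType F) (G H : zmodType)
    (C : G -> set A) (C' : H -> set A) (dC : direct_sum C) (dC' : direct_sum C') :
  refinement C C' -> forall g h x, C g x -> C g (component dC' h x).
Proof.
move=> ref g h x Cx.
suff -> : component dC' h x = component dC g (component dC' h x).
  exact: component_in.
rewrite -{1}(component_id dC Cx).
apply: (component_morph dC' dC' (f := component dC g) (d := id)) => //.
  exact: componentD.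
move=> k y C'y; have [->|y0] := eqVneq y 0.
  by rewrite component0; apply: family0 (direct_sum_zmod dC') k.
have [g' Cg'] : exists g', C' k `<=` C g' by apply: ref; exists y.
have [<-|gg'] := eqVneq g' g; first by rewrite component_id //; apply: Cg'.
rewrite (component_neq dC (Cg' _ C'y)) 1?eq_sym //.
exact: family0 (direct_sum_zmod dC') k.
Qed.

(** * Unit, inverses and support of a graded-division algebra *)

Section GradedDivision.
Variables (F : fieldType) (D : algType F) (G : zmodType) (D_ : G -> set D).
Hypothesis D_div : graded_division D_.

Let gD := graded_division_grading D_div.
Let dD := grading_direct_sum gD.

(** The degree-zero component of 1 is a left identity on homogeneous elements, hence on 1 itself,
    which is a sum of such elements. *)
Lemma graded_division1 : D_ 0 1.
Proof.
suff : 1 = component dD 0 1 :> D by move=> ->; apply: component_in.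
have id0 h x : D_ h x -> component dD 0 1 * x = x.
  move=> Dx; rewrite -(component_mulr (@mulrDl D) gD 0 1 Dx) mul1r add0r.
  exact: component_id.
rewrite -[RHS]mulr1; have [s [us _ {1 3}->]] := componentP dD 1.
by rewrite mulr_sumr; apply: eq_bigr => h _; rewrite (id0 h) //; apply: component_in.
Qed.

(** The inverse is not assumed homogeneous. Projecting [d * e = 1] to degree zero shows that the
    component of [e] of degree [- t] is already a right inverse of [d], so it is all of [e]. *)
Lemma graded_division_degV t d e : D_ t d -> d * e = 1 -> e * d = 1 -> D_ (- t) e.
Proof.
move=> Dd de ed.
suff <- : component dD (- t) e = e by apply: component_in.
rewrite -[LHS]mul1r -ed -mulrA -(component_mull (@mulrDr D) gD (- t) e Dd) subrr de.
by rewrite (component_id dD graded_division1) mulr1.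
Qed.

Lemma gsupp_hom t d : D_ t d -> d != 0 -> gsupp D_ t.
Proof. by exists d. Qed.

Lemma gsupp0 : gsupp D_ 0.
Proof. by exists 1; [apply: graded_division1|apply: oner_neq0]. Qed.

Lemma gsuppB t u : gsupp D_ t -> gsupp D_ u -> gsupp D_ (t - u).
Proof.
move=> [d Dd d0] [e De e0]; have [f [ef fe]] := graded_division_inv D_div De e0.
exists (d * f); first exact: grading_mul gD _ _ _ _ Dd (graded_division_degV De ef fe).
apply: contraNneq d0 => df0.
by rewrite -[d]mulr1 -fe mulrA df0 mul0r.
Qed.

Lemma gsuppN t : gsupp D_ t -> gsupp D_ (- t).
Proof. by rewrite -sub0r; apply/gsuppB/gsupp0. Qed.

Lemma gsuppD t u : gsupp D_ t -> gsupp D_ u -> gsupp D_ (t + u).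
Proof. by move=> Tt /gsuppN Tu; rewrite -[u]opprK; apply: gsuppB. Qed.

End GradedDivision.

(** * Graded matrix algebras *)

(** An isomorphism of R with the matrices over D, given through its entry functions. Any finite
    index type is allowed, so that a basis can be indexed by dependent pairs. *)
Record matrix_coordinates (F : fieldType) (R : lmodType F) (mul : R -> R -> R)
    (D : algType F) (I : finType) (m : R -> I -> I -> D) : Prop := {
  coordP : forall a x y p q, m (a *: x + y) p q = a *: m x p q + m y p q;
  coordM : forall x y p q, m (mul x y) p q = \sum_r m x p r * m y r q;
  coord_inj : forall x y, (forall p q, m x p q = m y p q) -> x = y;
  coord_surj : forall f : I -> I -> D, exists x, forall p q, m x p q = f p q
}.

Section MatrixCoordinates.
Variables (F : fieldType) (R : lmodType F) (mul : R -> R -> R).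
Variables (D : algType F) (I : finType) (m : R -> I -> I -> D).
Hypothesis mP : matrix_coordinates mul m.

Lemma coordD x y p q : m (x + y) p q = m x p q + m y p q.
Proof. by rewrite -[x]scale1r (coordP mP) !scale1r. Qed.

Lemma coord0 p q : m 0 p q = 0.
Proof. by apply: (addrI (m 0 p q)); rewrite -coordD !addr0. Qed.

Lemma coordZ a x p q : m (a *: x) p q = a *: m x p q.
Proof. by rewrite -[a *: x]addr0 (coordP mP) coord0 addr0. Qed.

Lemma coordB x y p q : m (x - y) p q = m x p q - m y p q.
Proof. by rewrite coordD -scaleN1r coordZ scaleN1r. Qed.

Lemma coord_sum (J : Type) (r : seq J) (P : pred J) (f : J -> R) p q :
  m (\sum_(j <- r | P j) f j) p q = \sum_(j <- r | P j) m (f j) p q.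
Proof.
exact: (big_morph (fun x => m x p q) (fun x y => coordD x y p q) (coord0 p q)).
Qed.

Lemma coord_mulDl : left_distributive mul +%R.
Proof.
move=> x y z; apply: (coord_inj mP) => p q; rewrite coordD !(coordM mP) -big_split.
by apply: eq_bigr => r _; rewrite coordD mulrDl.
Qed.

Lemma coord_mulDr : right_distributive mul +%R.
Proof.
move=> x y z; apply: (coord_inj mP) => p q; rewrite coordD !(coordM mP) -big_split.
by apply: eq_bigr => r _; rewrite coordD mulrDr.
Qed.

Definition of_coord (f : I -> I -> D) : R := sval (cid (coord_surj mP f)).

Lemma of_coordK f p q : m (of_coord f) p q = f p q.
Proof. by rewrite /of_coord; case: cid. Qed.

Definition munit p q (d : D) : R :=
  of_coord (fun i j => if (i == p) && (j == q) then d else 0).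

Lemma munitE p q d i j : m (munit p q d) i j = if (i == p) && (j == q) then d else 0.
Proof. exact: of_coordK. Qed.

Lemma munit_id p q d : m (munit p q d) p q = d.
Proof. by rewrite munitE !eqxx. Qed.

Lemma munit_mull p q d x i j :
  m (mul (munit p q d) x) i j = if i == p then d * m x q j else 0.
Proof.
rewrite (coordM mP) (bigD1 q) //= big1 ?addr0 => [|r rq].
  by rewrite munitE eqxx andbT; case: ifP => // _; rewrite mul0r.
by rewrite munitE (negPf rq) andbF mul0r.
Qed.

Lemma munit_mulr p q d x i j :
  m (mul x (munit p q d)) i j = if j == q then m x i p * d else 0.
Proof.
rewrite (coordM mP) (bigD1 p) //= big1 ?addr0 => [|r rq].
  by rewrite munitE eqxx /=; case: (j == q); rewrite ?mulr0.
by rewrite munitE (negPf rq) mulr0.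
Qed.

Lemma munitM p q r d e : mul (munit p q d) (munit q r e) = munit p r (d * e).
Proof.
apply: (coord_inj mP) => i j; rewrite munit_mull !munitE eqxx /=.
by case: (i == p); case: (j == r); rewrite ?mulr0.
Qed.

Lemma munitP a p q d e : munit p q (a *: d + e) = a *: munit p q d + munit p q e.
Proof.
apply: (coord_inj mP) => i j; rewrite (coordP mP) !munitE.
by case: ifP; rewrite ?scaler0 ?addr0.
Qed.

Lemma munitD p q d e : munit p q (d + e) = munit p q d + munit p q e.
Proof. by rewrite -[d]scale1r munitP !scale1r. Qed.

Lemma munit0 p q : munit p q 0 = 0.
Proof. by apply: (coord_inj mP) => i j; rewrite munitE coord0 if_same. Qed.

Lemma munitZ a p q d : munit p q (a *: d) = a *: munit p q d.
Proof. by rewrite -[a *: d]addr0 munitP munit0 addr0. Qed.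

Lemma munitB p q d e : munit p q (d - e) = munit p q d - munit p q e.
Proof. by rewrite munitD -[- e]scaleN1r munitZ scaleN1r. Qed.

Lemma munit_eq0 p q d : munit p q d = 0 -> d = 0.
Proof. by move=> /(congr1 (fun x => m x p q)); rewrite munit_id coord0. Qed.

Lemma munit_neq0 p q d : d != 0 -> munit p q d != 0.
Proof. by apply: contraNneq => /munit_eq0->. Qed.

Lemma munit_sum p q (J : Type) (r : seq J) (P : pred J) (f : J -> D) :
  munit p q (\sum_(j <- r | P j) f j) = \sum_(j <- r | P j) munit p q (f j).
Proof. exact: (big_morph _ (munitD p q) (munit0 p q)). Qed.

Lemma munit_decomp x : x = \sum_p \sum_q munit p q (m x p q).
Proof.
apply: (coord_inj mP) => i j; rewrite coord_sum (bigD1 i) //=.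
rewrite [X in _ + X]big1 => [|p pi].
  rewrite addr0 coord_sum (bigD1 j) //= [X in _ + X]big1 => [|q qj].
    by rewrite addr0 munit_id.
  by rewrite munitE [j == q]eq_sym (negPf qj) andbF.
by rewrite coord_sum big1 // => q _; rewrite munitE [i == p]eq_sym (negPf pi).
Qed.

Lemma munit_corner p q x :
  mul (mul (munit p p 1) x) (munit q q 1) = munit p q (m x p q).
Proof.
apply: (coord_inj mP) => i j; rewrite munit_mulr munit_mull !munitE mulr1 mul1r.
by case: (i == p); case: (j == q).
Qed.

Lemma coord_neq0 x : x != 0 -> exists p q, m x p q != 0.
Proof.
move=> x0; apply: contrapT => c0; case/eqP: x0.
apply: (coord_inj mP) => p q; rewrite coord0.
by apply: contrapT => /eqP mx0; apply: c0; exists p, q.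
Qed.

End MatrixCoordinates.

(** * Refinements of a matrix grading with separated degrees *)

Section MatrixGrading.
Variables (F : fieldType) (R : lmodType F) (mul : R -> R -> R).
Variables (D : algType F) (I : finType) (m : R -> I -> I -> D).
Hypothesis mP : matrix_coordinates mul m.
Variables (G : zmodType) (D_ : G -> set D) (R_ : G -> set R) (w : I -> G).
Hypotheses (D_div : graded_division D_) (gR : grading mul R_).
Hypothesis degP : forall g x, R_ g x <-> forall p q, D_ (g - w p + w q) (m x p q).

Let gD := graded_division_grading D_div.
Let dD := grading_direct_sum gD.
Let D_zmod := direct_sum_zmod dD.
Local Notation T := (gsupp D_).
Local Notation E := (munit mP).

(** Condition (1) in terms of the degrees of a whole homogeneous basis. The case [r = l] says that
    the degrees of distinct basis vectors are incongruent modulo T. *)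
Definition separated := forall p q r l, p <> q -> (p, q) <> (r, l) ->
  ~ T ((w p - w q) - (w r - w l)).

Lemma munit_deg p q t d : D_ t d -> R_ (w p - w q + t) (E p q d).
Proof.
move=> Dd; apply/degP => i j; rewrite munitE.
case: ifP => [/andP[/eqP-> /eqP->]|_]; last exact: family0 D_zmod _.
by rewrite -subrBA [_ + t]addrC addrK.
Qed.

Section Refinement.
Variables (H : zmodType) (C : H -> set R).
Hypotheses (gC : grading mul C) (ref : refinement R_ C).

Let dC := grading_direct_sum gC.
Let dR := grading_direct_sum gR.
Let C_zmod := direct_sum_zmod dC.
Let mulDl := coord_mulDl mP.
Let mulDr := coord_mulDr mP.

Hypothesis sep : separated.

(** The entry at (i, j) has degree [(w p - w q) - (w i - w j) + t]; if it were nonzero at a position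
    other than (p, q), separation would fail. *)
Lemma separated_supp p q t x : p <> q -> T t -> R_ (w p - w q + t) x ->
  x = E p q (m x p q).
Proof.
move=> pq Tt /degP Rx; apply: (coord_inj mP) => i j; rewrite munitE.
case: ifP => [/andP[/eqP-> /eqP->]//|ij].
have [->//|x0] := eqVneq (m x i j) 0.
have := gsuppB D_div (gsupp_hom (Rx i j) x0) Tt.
rewrite -subrBA addrAC addrK.
move=> /(sep pq); case => -[ip jq]; by rewrite ip jq !eqxx in ij.
Qed.

(** Components under [C] stay in the component of Gamma containing [E p q d], and by separation that
    one lives in the single block (p, q). *)
Lemma component_munit p q t d h : p <> q -> T t -> D_ t d ->
  exists2 e, D_ t e & component dC h (E p q d) = E p q e.
Proof.
move=> pq Tt Dd.
have RE := refinement_component dR dC ref h (munit_deg p q Dd).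
exists (m (component dC h (E p q d)) p q); last exact: separated_supp RE.
move/degP/(_ p q): RE.
by rewrite -subrBA [_ + t]addrC addrK.
Qed.

Lemma homogeneous_munit p q : p <> q ->
  exists h c, [/\ D_ 0 c, c != 0 & C h (E p q c)].
Proof.
move=> pq; have := munit_neq0 mP p q (oner_neq0 D).
move=> /(component_neq0 dC)[h Eh].
have [c Dc Ec] := component_munit h pq (gsupp0 D_div) (graded_division1 D_div).
exists h, c; rewrite -Ec; split => //; last exact: component_in.
by apply: contraNneq Eh => c0; rewrite Ec c0 munit0.
Qed.

(** The diagonal blocks all have the same degrees, so separation does not isolate them; a
    homogeneous element of block (p, p) is obtained as a product of homogeneous elements of (p, q)
    and (q, p). *)
Lemma homogeneous_diag p : exists h c e, c * e = 1 /\ C h (E p p c).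
Proof.
have inv c : D_ 0 c -> c != 0 -> exists e, c * e = 1.
  by move=> Dc /(graded_division_inv D_div Dc)[e [ce _]]; exists e.
have [[q pq]|] := pselect (exists q, p <> q).
  have [h [c [Dc c0 Cc]]] := homogeneous_munit pq.
  have [k [d [Dd d0 Cd]]] := homogeneous_munit (nesym pq).
  have [e ce] := inv _ Dc c0; have [f df] := inv _ Dd d0.
  exists (h + k), (c * d), (f * e); split.
    by rewrite -mulrA [d * _]mulrA df mul1r ce.
  by rewrite -(munitM mP p q p); apply: grading_mul gC _ _ _ _ Cc Cd.
(* With a single index, R is one block, and a nonzero component of [E p p 1] has an invertible entry
   of degree zero. *)
move=> /forallNP alone.
have all_p q : q = p by apply: contrapT => /nesym; apply: alone.
have := munit_neq0 mP p p (oner_neq0 D).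
move=> /(component_neq0 dC)[h Eh].
set y := component dC h (E p p 1).
have yE : y = E p p (m y p p).
  by apply: (coord_inj mP) => i j; rewrite (all_p i) (all_p j) munit_id.
have Ry : R_ 0 y.
  apply: (refinement_component dR dC ref).
  by have := munit_deg p p (graded_division1 D_div); rewrite subrr addr0.
have [e ye] : exists e, m y p p * e = 1.
  apply: inv; first by move/degP/(_ p p): Ry; rewrite sub0r addNr.
  by apply: contraNneq Eh => y0; rewrite -/y yE y0 munit0.
by exists h, (m y p p), e; split=> //; rewrite -yE; apply: component_in.
Qed.

(* The degree-zero component of [E p p 1] acts on the homogeneous elements
   [E q q c] as [E p p 1] itself does, and each of these is invertible in its
   block. *)
Lemma idempotent_deg0 p : C 0 (E p p 1).
Proof.
suff <- : component dC 0 (E p p 1) = E p p 1 by apply: component_in.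
apply: (coord_inj mP) => i q.
have [h [c [e [ce Cc]]]] := homogeneous_diag q.
have := component_mulr mulDl gC 0 (E p p 1) Cc.
have Epq : component dC (0 + h) (mul (E p p 1) (E q q c)) = mul (E p p 1) (E q q c).
  rewrite add0r; have [->|pq] := eqVneq p q.
    by rewrite munitM mul1r; apply: component_id.
  suff -> : mul (E p p 1) (E q q c) = 0 by rewrite component0.
  apply: (coord_inj mP) => k l; rewrite munit_mull munitE (coord0 mP) (negPf pq) /=.
  by rewrite mulr0 if_same.
rewrite Epq => /(congr1 (fun x => m x i q)); rewrite !munit_mulr eqxx.
by move=> /(congr1 (fun x => x * e)); rewrite -!mulrA ce !mulr1.
Qed.

(** Multiplying on both sides by idempotents of degree zero cuts out a block without changing the
    degree. *)
Lemma homogeneous_block h p q x : C h x -> C h (E p q (m x p q)).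
Proof.
move=> Cx; rewrite -munit_corner -[h]addr0 -[h]add0r.
apply: (grading_mul gC); last exact: idempotent_deg0.
by apply: (grading_mul gC) => //; apply: idempotent_deg0.
Qed.

(** Projections of [C] commute with multiplication by the degree-zero idempotents, hence preserve
    every block. *)
Lemma component_block h p q d :
  component dC h (E p q d) = E p q (m (component dC h (E p q d)) p q).
Proof.
have := component_mulr mulDl gC h (mul (E p p 1) (E p q d)) (idempotent_deg0 q).
have := component_mull mulDr gC h (E p q d) (idempotent_deg0 p).
rewrite add0r addr0 -(munit_corner mP) !munitM.
by rewrite !mul1r mulr1 -/dC => <-.
Qed.

(** Let [z] be the component of [E q p e] of degree [- h]. Projecting to degree zero, [z] times
    [E p q d] is [E q q 1]; cancelling [d] shows that [z] is all of [E q p e]. *)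
Lemma homogeneous_inv h p q d e :
  e * d = 1 -> d * e = 1 -> C h (E p q d) -> C (- h) (E q p e).
Proof.
move=> ed de Cd; have := component_mulr mulDl gC (- h) (E q p e) Cd.
rewrite addNr munitM ed (component_id _ (idempotent_deg0 q)).
rewrite -/dC component_block munitM => /(congr1 (fun x => m x q q)).
rewrite !munit_id => /(congr1 (fun x => x * e)); rewrite mul1r -mulrA de mulr1.
by move=> ->; rewrite -component_block; apply: component_in.
Qed.

(** The corner (p, p) is a copy of D, stable under the projections of [C]. Fineness of Gamma_0 will
    be applied to this grading of D by H. *)
Lemma corner_grading p : grading *%R (fun h => [set d | C h (E p p d)]).
Proof.
split.
- pose pr h d := m (component dC h (E p p d)) p p.
  apply: (@direct_sumI _ _ _ pr).
  + move=> h; split=> [|x y /= Cx Cy]; rewrite /= ?munit0 ?munitB.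
      exact: family0 C_zmod _.
    exact: familyB C_zmod _ _ _ Cx Cy.
  + move=> d; have [s [us sd dE]] := componentP dC (E p p d).
    exists s, (pr^~ d); split=> [h _|].
      by split=> //=; rewrite /pr -component_block; apply: component_in.
    by rewrite -(coord_sum mP) // -dE munit_id.
  + by move=> h x y; rewrite /pr munitD componentD (coordD mP).
  + by move=> h d /= Cd; rewrite /pr component_id // munit_id.
  + by move=> h k d /= Cd hk; rewrite /pr (component_neq _ Cd) // (coord0 mP).
- by move=> h a d /= Cd; rewrite munitZ; apply: (grading_scale gC).
- by move=> h k d e /= Cd Ce; rewrite -(munitM mP p p p); apply: (grading_mul gC).
Qed.

Hypothesis D_fine : fine *%R D_.

(** The corner grading refines Gamma_0. If its component through [d] missed an element of [D_ t],
    the refinement would be proper. *)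
Lemma corner_full p h t d d' : C h (E p p d) -> D_ t d -> d != 0 -> D_ t d' ->
  C h (E p p d').
Proof.
move=> Cd Dd d0 Dd'; pose C' h := [set d | C h (E p p d)].
have RC k x : C k (E p p x) -> x != 0 -> exists g, C' k `<=` D_ g.
  move=> Cx x0; have [g Rg] : exists g, C k `<=` R_ g.
    by apply: ref; exists (E p p x) => //; apply: munit_neq0.
  exists g => y /Rg/degP/(_ p p).
  by rewrite munit_id subrK.
have [g Dg] := RC _ _ Cd d0.
have gt : g = t by apply: (direct_sum_eq dD (Dg _ Cd) Dd d0).
apply: contrapT => nC; apply: (D_fine (corner_grading p)); split.
  by move=> k [x Cx x0]; apply: RC Cx x0.
exists h, t; split; first by exists d.
split; first by rewrite -gt.
by move=> /(_ _ Dd').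
Qed.

(** Write [d' = d * (e * d')] with [e] inverse to [d]: the second factor has degree zero in D, and
    [corner_full] gives it, at (q, q), the degree of [E q q 1], which is zero. *)
Lemma block_full h p q t d d' : C h (E p q d) -> D_ t d -> d != 0 -> D_ t d' ->
  C h (E p q d').
Proof.
move=> Cd Dd d0 Dd'; have [e [de ed]] := graded_division_inv D_div Dd d0.
have De := graded_division_degV D_div Dd de ed.
rewrite -[d']mul1r -de -mulrA -(munitM mP p q q) -[h]addr0.
apply: (grading_mul gC) => //.
apply: corner_full (idempotent_deg0 q) (graded_division1 D_div) (oner_neq0 _) _.
by rewrite -(addNr t); apply: (grading_mul gD).
Qed.

(** This excludes strict inclusions. The entries of [y] are treated one at a time, according to the
    position (p, q) of a nonzero entry of [x]. *)
Lemma homogeneous_full h g x : C h x -> x != 0 -> C h `<=` R_ g -> R_ g `<=` C h.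
Proof.
move=> Cx x0 CR y Ry; have [p [q xpq]] := coord_neq0 mP x0.
have Cpq := homogeneous_block p q Cx.
have /degP Rx := CR _ Cx; have /degP Ry' := Ry.
rewrite (munit_decomp mP y); apply: (family_sum C_zmod) => k _.
apply: (family_sum C_zmod) => l _.
have [->|ykl] := eqVneq (m y k l) 0; first by rewrite munit0; apply: family0 C_zmod _.
have Tx := gsupp_hom (Rx p q) xpq; have Ty := gsupp_hom (Ry' k l) ykl.
(* If p <> q, separation makes (p, q) the only position where elements of [R_ g] can be nonzero. *)
have [pq|/eqP pq] := eqVneq p q; last first.
  move: (gsuppB D_div Ty Tx); rewrite -[_ + w l]subrBA -[_ + w q]subrBA subrBB => Tpq.
  have [kp lq] : k = p /\ l = q.
    by apply: contrapT => klpq; apply: (sep pq) Tpq => -[pk ql]; apply: klpq.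
  by rewrite kp lq in ykl *; apply: block_full Cpq (Rx p q) xpq _; rewrite -lq -kp.
(* Here p = q, and a nonzero entry of [y] off the diagonal would put [w k - w l] in T. *)
have [kl|/eqP kl] := eqVneq k l; last first.
  have := gsuppB D_div Tx Ty; rewrite -[_ + w q]subrBA -[_ + w l]subrBA subrBB => Tkl.
  by case: (sep kl _ Tkl); rewrite -pq => -[kp lp]; apply: kl; rewrite kp lp.
rewrite -kl in ykl *; rewrite -pq in xpq Cpq Tx => {kl pq l q Ty}.
move: (Rx p p) (Ry' k k); rewrite -!subrBA !subrr !subr0 => Dx Dy.
have [kp|/eqP kp] := eqVneq k p.
  by rewrite kp in Dy *; apply: block_full Cpq Dx xpq Dy.
have [j [c [Dc c0 Cc]]] := homogeneous_munit kp.
have [e [ce ec]] := graded_division_inv D_div Dc c0.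
have De := graded_division_degV D_div Dc ce ec.
have Ce := homogeneous_inv ec ce Cc.
(* Conjugation by the homogeneous [E k p c] moves the entry to the corner p, where [block_full]
   applies; the degrees [j] and [- j] cancel, and [c] has degree zero in D. *)
have -> : m y k k = c * (e * m y k k * c) * e.
  by rewrite !mulrA ce mul1r -mulrA ce mulr1.
rewrite -(munitM mP k p k) -(munitM mP k p p) -(addrK j h) [h + j]addrC.
apply: (grading_mul gC) => //; apply: (grading_mul gC) => //.
apply: block_full Cpq Dx xpq _.
rewrite -[g]addr0; apply: (grading_mul gD) => //.
by rewrite -[g]add0r -oppr0; apply: (grading_mul gD).
Qed.

End Refinement.

Lemma separated_fine : separated -> fine *%R D_ -> fine mul R_.
Proof.
move=> sep D_fine H C gC [ref [h [g [[x Cx x0] [CR RC]]]]].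
by apply: RC; apply: (homogeneous_full gC ref sep D_fine) Cx x0 CR.
Qed.

End MatrixGrading.

(** * The refinement by H x Z^I and its consequences for a fine grading *)

(** This is e_p - e_q in the free abelian group Z^I, where distinct off-diagonal positions receive
    distinct degrees. *)
Definition elem_degree (I : finType) (p q : I) : {ffun I -> int} :=
  [ffun i => (i == p)%:R - (i == q)%:R].

Lemma elem_degreeD (I : finType) (p q r : I) :
  elem_degree p q + elem_degree q r = elem_degree p r.
Proof. by apply/ffunP => i; rewrite !ffunE addrA subrK. Qed.

Lemma elem_degree_inj (I : finType) (p q r l : I) :
  elem_degree p q = elem_degree r l -> p <> q -> (p, q) = (r, l).
Proof.
move=> /ffunP e /eqP pq; have := e p; have := e q.
rewrite !ffunE !eqxx eq_sym (negPf pq).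
have [->|_] := eqVneq p r; have [->|_] := eqVneq q l => //;
  by case: eqP => // _; case: eqP.
Qed.

(** Only diagonal positions share a degree in Z^I, and their weight differences all vanish. This is
    what makes the grading by H x Z^I refine Gamma. *)
Lemma elem_degree_weight (I : finType) (G : zmodType) (w : I -> G) (p q r l : I) :
  elem_degree p q = elem_degree r l -> w p - w q = w r - w l.
Proof.
move=> e; have [pq|/eqP pq] := eqVneq p q; last first.
  by case: (elem_degree_inj e pq) => -> ->.
have [rl|/eqP rl] := eqVneq r l; first by rewrite pq rl !subrr.
by case: (elem_degree_inj (esym e) rl) => -> ->.
Qed.

Section MatrixRefinement.
Variables (F : fieldType) (R : lmodType F) (mul : R -> R -> R).
Variables (D : algType F) (I : finType) (m : R -> I -> I -> D).
Hypothesis mP : matrix_coordinates mul m.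
Variables (G : zmodType) (D_ : G -> set D) (R_ : G -> set R) (w : I -> G).
Hypothesis degP : forall g x, R_ g x <-> forall p q, D_ (g - w p + w q) (m x p q).
Hypothesis D_zmod : forall g, D_ g 0 /\
  (forall x y, D_ g x -> D_ g y -> D_ g (x - y)).
Variables (H : zmodType) (D' : H -> set D).
Hypotheses (gD' : grading *%R D') (ref : refinement D_ D').

Let dD' := grading_direct_sum gD'.
Let D'_zmod := direct_sum_zmod dD'.

(** Zero entries leave [k.2] unconstrained, so that 0 belongs to every component; the diagonal
    positions all share [k.2 = 0]. *)
Definition matrix_grading (k : H * {ffun I -> int}) : set R :=
  [set x | forall p q, D' k.1 (m x p q) /\ (m x p q != 0 -> k.2 = elem_degree p q)].

Lemma matrix_grading_munit h p q d : D' h d ->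
  matrix_grading (h, elem_degree p q) (munit mP p q d).
Proof.
move=> Dd i j; rewrite munitE; case: ifP => [/andP[/eqP-> /eqP->]//|_].
by split=> /=; [apply: family0 D'_zmod _|rewrite eqxx].
Qed.

Lemma matrix_grading_zmod k : matrix_grading k 0 /\
  (forall x y, matrix_grading k x -> matrix_grading k y -> matrix_grading k (x - y)).
Proof.
split=> [p q|x y Cx Cy p q].
  by rewrite (coord0 mP) eqxx; split=> //; apply: family0.
have [Dx xk] := Cx p q; have [Dy yk] := Cy p q; rewrite (coordB mP).
split; first exact: (familyB D'_zmod).
have [x0|/xk//] := eqVneq (m x p q) 0.
by have [y0|/yk//] := eqVneq (m y p q) 0; rewrite x0 y0 subrr eqxx.
Qed.

Lemma matrix_grading_direct_sum : direct_sum matrix_grading.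
Proof.
pose pr (k : H * {ffun I -> int}) x := of_coord mP (fun p q =>
  if k.2 == elem_degree p q then component dD' k.1 (m x p q) else 0).
apply: (@direct_sumI _ _ _ pr); first exact: matrix_grading_zmod.
- move=> x; rewrite (munit_decomp mP x).
  apply: (sum_over_sum matrix_grading_zmod) => p _.
  apply: (sum_over_sum matrix_grading_zmod) => q _.
  have [s [_ _ ->]] := componentP dD' (m x p q).
  rewrite munit_sum; apply: (sum_over_sum matrix_grading_zmod) => h _.
  apply: (sum_over1 (i := (h, elem_degree p q))) => //.
  by apply: matrix_grading_munit; apply: component_in.
- move=> k x y; apply: (coord_inj mP) => p q; rewrite (coordD mP) !of_coordK.
  by case: ifP; rewrite ?addr0 // (coordD mP) componentD.
- move=> k x Cx; apply: (coord_inj mP) => p q; rewrite of_coordK.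
  have [Dx xk] := Cx p q; rewrite component_id //; case: eqP => // kpq.
  by apply/esym/eqP; apply: contra_notT kpq => /xk.
- move=> k l x Cx kl; apply: (coord_inj mP) => p q; rewrite of_coordK (coord0 mP).
  have [Dx xl] := Cx p q; case: eqP => // kpq.
  have [->|/xl lpq] := eqVneq (m x p q) 0; first exact: component0.
  apply: component_neq Dx _; apply: contraNneq kl => kl1.
  by rewrite (surjective_pairing k) (surjective_pairing l) kl1 kpq lpq.
Qed.

Lemma matrix_gradingP : grading mul matrix_grading.
Proof.
split; first exact: matrix_grading_direct_sum.
- move=> k a x Cx p q; rewrite (coordZ mP); have [Dx xk] := Cx p q.
  split; first exact: (grading_scale gD').
  by move=> ax0; apply: xk; apply: contraNneq ax0 => ->; rewrite scaler0.
- move=> k l x y Cx Cy p q; rewrite (coordM mP); split.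
    apply: (family_sum D'_zmod) => r _.
    by apply: (grading_mul gD'); [case: (Cx p r)|case: (Cy r q)].
  (* A nonzero entry of the product has a nonzero term, whose two factors determine [k.2] and [l.2];
     their sum telescopes. *)
  move=> xy0; have [r xr yr] : exists2 r, m x p r != 0 & m y r q != 0.
    apply: contrapT => none; case/eqP: xy0; apply: big1 => r _.
    have [->|xr] := eqVneq (m x p r) 0; first by rewrite mul0r.
    have [->|yr] := eqVneq (m y r q) 0; first by rewrite mulr0.
    by case: none; exists r.
  have [_ /(_ xr) kr] := Cx p r; have [_ /(_ yr) lr] := Cy r q.
  by rewrite /= kr lr elem_degreeD.
Qed.

Lemma matrix_grading_sub h p q t : D' h `<=` D_ t ->
  matrix_grading (h, elem_degree p q) `<=` R_ (w p - w q + t).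
Proof.
move=> Dt x Cx; apply/degP => i j; have [/= /Dt Dx xk] := Cx i j.
have [->|/xk/(elem_degree_weight w)->] := eqVneq (m x i j) 0.
  exact: family0 D_zmod _.
by rewrite -subrBA [_ + t]addrC addrK.
Qed.

Lemma matrix_grading_refinement : refinement R_ matrix_grading.
Proof.
move=> k [x Cx /(coord_neq0 mP)[p [q xpq]]]; have [Dx /(_ xpq) kpq] := Cx p q.
have [t Dt] : exists t, D' k.1 `<=` D_ t by apply: ref; exists (m x p q).
exists (w p - w q + t); rewrite (surjective_pairing k) kpq.
exact: matrix_grading_sub.
Qed.

(** The opposite inclusion is [matrix_grading_sub]; were it strict, the new grading would properly
    refine Gamma, the component being nonzero since it contains E_pq(d). *)
Lemma fine_matrix_grading h p q t d : fine mul R_ ->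
  D' h d -> d != 0 -> D' h `<=` D_ t ->
  R_ (w p - w q + t) `<=` matrix_grading (h, elem_degree p q).
Proof.
move=> R_fine Dd d0 Dt; apply: contrapT => nsub.
apply: (R_fine _ _ matrix_gradingP); split; first exact: matrix_grading_refinement.
exists (h, elem_degree p q), (w p - w q + t); split.
  by exists (munit mP p q d); [apply: matrix_grading_munit|apply: munit_neq0].
by split=> //; apply: matrix_grading_sub.
Qed.

End MatrixRefinement.

Section FineMatrix.
Variables (F : fieldType) (R : lmodType F) (mul : R -> R -> R).
Variables (D : algType F) (I : finType) (m : R -> I -> I -> D).
Hypothesis mP : matrix_coordinates mul m.
Variables (G : zmodType) (D_ : G -> set D) (R_ : G -> set R) (w : I -> G).
Hypothesis D_div : graded_division D_.
Hypothesis degP : forall g x, R_ g x <-> forall p q, D_ (g - w p + w q) (m x p q).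
Hypothesis R_fine : fine mul R_.

Let gD := graded_division_grading D_div.
Let D_zmod := direct_sum_zmod (grading_direct_sum gD).

(** On the diagonal the weights cancel: for [c] in [D_ t], E_pp(c) has degree [t] in Gamma. Fineness
    of Gamma puts it in the component of degree (h, 0), hence [c] in [D' h]. *)
Lemma fine_entries : I -> fine *%R D_.
Proof.
move=> p H D' gD' [ref [h [t [[d Dd d0] [DD nDD]]]]]; apply: nDD => c Dc.
have Rc := munit_deg mP D_div degP p p Dc.
have := fine_matrix_grading mP degP D_zmod gD' ref R_fine Dd d0 DD Rc.
by move=> /(_ p p)[]; rewrite munit_id.
Qed.

(** Take D' = Gamma_0. If [d] is nonzero of degree (w_p - w_q) - (w_r - w_l), then E_rl(d) and
    E_pq(1) have the same degree in Gamma, so E_rl(d) has degree (0, e_p - e_q), which forces (r, l)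
    = (p, q). *)
Lemma fine_separated : separated D_ w.
Proof.
move=> p q r l pq pqrl [d Dd d0].
have ref : refinement D_ D_ by move=> h _; exists h.
have RE : R_ (w p - w q + 0) (munit mP r l d).
  have := munit_deg mP D_div degP r l Dd; congr (R_ _ _).
  by rewrite addr0 addrC subrK.
have := fine_matrix_grading mP degP D_zmod gD ref R_fine (graded_division1 D_div)
  (oner_neq0 D) (fun _ => id) RE.
move=> /(_ r l)[_]; rewrite munit_id => /(_ d0) e.
by apply: pqrl; apply: elem_degree_inj e pq.
Qed.

End FineMatrix.

(** The premise [I] makes the index type nonempty: fineness of Gamma_0 is read off a diagonal
    corner. *)
Lemma fine_matrix (F : fieldType) (R : lmodType F) (mul : R -> R -> R)
    (D : algType F) (I : finType) (m : R -> I -> I -> D) (G : zmodType)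
    (D_ : G -> set D) (R_ : G -> set R) (w : I -> G) :
  matrix_coordinates mul m -> graded_division D_ -> grading mul R_ ->
  (forall g x, R_ g x <-> forall p q, D_ (g - w p + w q) (m x p q)) -> I ->
  fine mul R_ <-> separated D_ w /\ fine *%R D_.
Proof.
move=> mP D_div gR degP p; split=> [R_fine|[sep D_fine] H C gC].
  split; first exact: (fine_separated mP D_div degP R_fine).
  by move=> H C gC; apply: (fine_entries mP D_div degP R_fine p gC).
exact: (separated_fine mP D_div gR degP sep D_fine gC).
Qed.

(** * Graded modules *)

Section HomogeneousBasis.
Variables (F : fieldType) (D : algType F) (G : zmodType) (D_ : G -> set D).
Variables (V : lmodType D^c) (V_ : G -> set V).
Hypotheses (D_div : graded_division D_) (V_graded : graded_module D_ V_).
Variables (I : finType) (b : I -> V) (w : I -> G).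
Hypothesis b_hom : forall p, V_ (w p) (b p).
Hypothesis b_span : forall v, exists c : I -> D^c, v = \sum_p c p *: b p.
Hypothesis b_free : forall c : I -> D^c, \sum_p c p *: b p = 0 -> forall p, c p = 0.

Let dD := grading_direct_sum (graded_division_grading D_div).
Let dV := graded_module_direct_sum V_graded.
Let V_zmod := direct_sum_zmod dV.

Definition coef v : I -> D^c := sval (cid (b_span v)).

Lemma coefP v : v = \sum_p coef v p *: b p.
Proof. by rewrite /coef; case: cid. Qed.

Lemma coef_uniq (c : I -> D^c) v : v = \sum_p c p *: b p -> forall p, coef v p = c p.
Proof.
move=> vE p; apply/eqP; rewrite -subr_eq0; apply/eqP.
apply: (b_free (c := fun p => coef v p - c p)).
under eq_bigr do rewrite scalerBl.
by rewrite sumrB -coefP -vE subrr.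
Qed.

Lemma coef_linear a u v p : coef (a *: u + v) p = a * coef u p + coef v p.
Proof.
move: p; apply: coef_uniq.
under eq_bigr do rewrite scalerDl -scalerA.
by rewrite big_split -scaler_sumr -!coefP.
Qed.

Lemma component_scale g h (v : V) (d : D) :
  V_ h v -> component dV (h + g) ((d : D^c) *: v) = (component dD g d : D^c) *: v.
Proof.
move=> Vv; apply: (component_morph dD dV (f := fun d : D => (d : D^c) *: v)
  (d := fun g => h + g)).
- by move=> c e; rewrite -scalerDl.
- exact: addrI.
- by move=> g' c Dc; apply: graded_module_scale V_graded _ _ _ _ Vv Dc.
Qed.

(** Projecting the expansion of [v] to degree [h] replaces each coefficient by its component of
    degree [h - w p]; uniqueness of the coefficients concludes. *)
Lemma coef_deg h v p : V_ h v -> D_ (h - w p) (coef v p).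
Proof.
move=> Vv.
suff -> : coef v p = component dD (h - w p) (coef v p) by apply: component_in.
move: p; apply: coef_uniq.
rewrite -{1}(component_id dV Vv) {1}(coefP v) component_sum; apply: eq_bigr => p _.
by rewrite -{1}[h](subrK (w p)) addrC component_scale.
Qed.

Section Coordinates.
Variables (R : lmodType F) (mul : R -> R -> R) (R_ : G -> set R).
Variable phi : R -> {linear V -> V}.
Hypothesis R_iso : graded_iso_End V_ mul R_ phi.

Definition coord x p q : D := coef (phi x (b q)) p.

Lemma coord_phi x q : phi x (b q) = \sum_p (coord x p q : D^c) *: b p.
Proof. exact: coefP. Qed.

Lemma phiE x v : phi x v = \sum_q coef v q *: \sum_p (coord x p q : D^c) *: b p.
Proof.
rewrite {1}(coefP v) linear_sum; apply: eq_bigr => q _.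
by rewrite linearZ -coord_phi.
Qed.

Definition endo (f : I -> I -> D) (v : V) : V :=
  \sum_q coef v q *: \sum_p (f p q : D^c) *: b p.

Lemma endo_linear f : linear (endo f).
Proof.
move=> a u v; rewrite /endo scaler_sumr -big_split; apply: eq_bigr => q _.
by rewrite coef_linear scalerDl scalerA.
Qed.

Lemma coord_coordinates : matrix_coordinates mul coord.
Proof.
split.
- move=> a x y p q; rewrite /coord.
  have -> : phi (a *: x + y) (b q) = (a%:A : D^c) *: phi x (b q) + phi y (b q).
    exact: (graded_iso_linear R_iso).
  rewrite coef_linear; congr (_ + _).
  (* Left multiplication by [a%:A] in [D^c] is right multiplication in D, hence scaling by [a]. *)
  have -> : (a%:A : D^c) * coef (phi x (b q)) p =
      (coef (phi x (b q)) p : D) * (a%:A : D) by [].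
  by rewrite -scalerAr mulr1.
- move=> x y p q; move: p; apply: coef_uniq.
  rewrite (graded_iso_mul R_iso) phiE.
  under eq_bigr do rewrite scaler_sumr.
  rewrite exchange_big; apply: eq_bigr => p _ /=.
  (* Coefficients multiply in [D^c], which reverses the factors: the result is the matrix product
     over D. *)
  under eq_bigr do rewrite scalerA.
  by rewrite -scaler_suml.
- move=> x y xy; apply: (graded_iso_inj R_iso) => v; rewrite !phiE.
  by apply: eq_bigr => q _; congr (_ *: _); apply: eq_bigr => p _; rewrite xy.
- move=> f; pose L : {linear V -> V} :=
    HB.pack (endo f) (GRing.isLinear.Build _ _ _ _ _ (endo_linear f)).
  have [x xL] := graded_iso_surj R_iso L; exists x => p q.
  move: p; apply: coef_uniq; rewrite xL /= /endo (bigD1 q) //=.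
  have bq r : coef (b q) r = (r == q)%:R.
    move: r; apply: coef_uniq; rewrite (bigD1 q) //= eqxx scale1r big1 ?addr0 //.
    by move=> r /negPf->; rewrite scale0r.
  rewrite bq eqxx scale1r [X in _ + X]big1 ?addr0 // => r rq.
  by rewrite bq (negPf rq) scale0r.
Qed.

Lemma coord_deg g x : R_ g x <-> forall p q, D_ (g - w p + w q) (coord x p q).
Proof.
split=> [/(graded_iso_degree R_iso) Rx p q|Dx].
  by rewrite addrAC; apply/coef_deg/Rx.
apply/(graded_iso_degree R_iso) => h v Vv; rewrite phiE.
apply: (family_sum V_zmod) => q _; rewrite scaler_sumr.
apply: (family_sum V_zmod) => p _; rewrite scalerA.
have <- : w p + ((g - w p + w q) + (h - w q)) = g + h.
  by rewrite addrACA subrr addr0 addrA [w p + _]addrC subrK.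
apply: (graded_module_scale V_graded) => //.
exact: (grading_mul (graded_division_grading D_div) (Dx p q) (coef_deg q Vv)).
Qed.

End Coordinates.

Lemma fine_basis (R : lmodType F) (mul : R -> R -> R) (R_ : G -> set R)
    (phi : R -> {linear V -> V}) : I ->
  grading mul R_ -> graded_iso_End V_ mul R_ phi ->
  fine mul R_ <-> separated D_ w /\ fine *%R D_.
Proof.
move=> p gR R_iso.
exact: (fine_matrix (coord_coordinates R_iso) D_div gR (coord_deg R_iso) p).
Qed.

End HomogeneousBasis.

(** * A homogeneous basis of V assembled from its isotypic components *)

Section Isotypic.
Variables (F : fieldType) (D : algType F) (G : zmodType) (D_ : G -> set D).
Variables (V : lmodType D^c) (V_ : G -> set V).
Hypotheses (D_div : graded_division D_) (V_graded : graded_module D_ V_).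
Variables (s : nat) (g : 'I_s -> G) (k : 'I_s -> nat).
Local Notation T := (gsupp D_).
Hypothesis g_distinct : injective (fun i => coset T (g i)).
Hypothesis g_supports : [set graded_supp V_ W | W in isotypic_components D_ V_] =
  range (fun i => coset T (g i)).
Hypothesis k_dim : forall i, has_dim V_ (isotypic D_ V_ (g i)) (k i).

Let dV := graded_module_direct_sum V_graded.

Lemma coset_refl h : coset T h h.
Proof. by rewrite /coset /= subrr; apply: gsupp0. Qed.

Lemma gsupp_congr h l : T (h - l) -> T h <-> T l.
Proof.
move=> Thl; split=> [Th|Tl]; last by rewrite -(subrK l h); apply: gsuppD.
have -> : l = h - (h - l) by rewrite opprB addrC subrK.
exact: gsuppB.
Qed.

Lemma coset_eq h l : coset T h l -> coset T h = coset T l.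
Proof.
move=> Thl; apply/seteqP; split=> x /= Tx; rewrite /coset /=.
  have -> : x - l = (x - h) - (l - h) by rewrite opprB addrA subrK.
  exact: gsuppB.
have -> : x - h = (x - l) + (l - h) by rewrite addrA subrK.
exact: gsuppD.
Qed.

Lemma coset_index_inj h i j : coset T (g i) h -> coset T (g j) h -> i = j.
Proof. by move=> /coset_eq hi /coset_eq hj; apply: g_distinct; rewrite /= hi hj. Qed.

Lemma isotypic_deg h l v : V_ h v -> v != 0 -> isotypic D_ V_ l v -> coset T l h.
Proof.
move=> Vv v0 Wv; apply: contrapT => nT; case/eqP: v0.
by rewrite -(component_id dV Vv); apply: component_notin Wv nT.
Qed.

(** The isotypic component of [h] contains [v], so it is nonzero, and its support, which contains
    [h], is one of the listed cosets. *)
Lemma isotypic_cover h v : V_ h v -> v != 0 -> exists i, coset T (g i) h.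
Proof.
move=> Vv v0; have Wv : isotypic D_ V_ h v by apply: sum_over1 Vv; apply: coset_refl.
have : range (fun i => coset T (g i)) (graded_supp V_ (isotypic D_ V_ h)).
  by rewrite -g_supports; exists (isotypic D_ V_ h) => //; split; [exists h|exists v].
move=> [i _ gi]; exists i; rewrite [coset T (g i)]gi.
by exists v.
Qed.

(** The coset of [g i] is the support of an isotypic component and contains [g i]; hence V has
    nonzero elements of degree [g i]. *)
Lemma isotypic_neq0 i : exists2 v, isotypic D_ V_ (g i) v & v != 0.
Proof.
have [W _ WE] : [set graded_supp V_ W | W in isotypic_components D_ V_] (coset T (g i)).
  by rewrite g_supports; exists i.
have := coset_refl (g i); rewrite -WE => -[v [Vv _] v0].
by exists v => //; apply: sum_over1 Vv; apply: coset_refl.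
Qed.

Lemma isotypic_dim_gt0 i : (0 < k i)%N.
Proof.
have [v Wv v0] := isotypic_neq0 i; have [b [_ WE _]] := k_dim i.
rewrite lt0n; apply: contra_neqT v0 => /negbNE/eqP k0.
move: Wv; rewrite WE => -[c ->]; apply: big1 => j _.
by have := ltn_ord j; rewrite {2}k0.
Qed.

Local Notation index := {i : 'I_s & 'I_(k i)}.
Local Notation idx j := (Tagged (fun i : 'I_s => 'I_(k i)) j).

Definition isotypic_basis (p : index) : V := sval (cid (k_dim (tag p))) (tagged p).

Lemma isotypic_basisP i :
  [/\ forall j, exists h, V_ h (isotypic_basis (idx (j : 'I_(k i)))),
      isotypic D_ V_ (g i) = [set v | exists c : 'I_(k i) -> D^c,
        v = \sum_(j < k i) c j *: isotypic_basis (idx j)]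
    & forall c : 'I_(k i) -> D^c,
        \sum_(j < k i) c j *: isotypic_basis (idx j) = 0 -> forall j, c j = 0].
Proof. by rewrite /isotypic_basis /=; case: cid => b /=. Qed.

(** [has_dim] provides only some degree. The vector is nonzero by independence and lies in its
    isotypic component, which places its degree in the coset. *)
Lemma isotypic_basis_deg p : exists2 h, V_ h (isotypic_basis p) & coset T (g (tag p)) h.
Proof.
case: p => i j; have [b_hom WE b_free] := isotypic_basisP i.
have [h Vh] := b_hom j; exists h => //=.
have bj : \sum_l (l == j)%:R *: isotypic_basis (idx l) = isotypic_basis (idx j).
  rewrite (bigD1 j) //= eqxx scale1r big1 ?addr0 // => l /negPf->.
  by rewrite scale0r.
apply: (isotypic_deg Vh); last by rewrite WE; exists (fun l => (l == j)%:R); rewrite bj.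
apply/eqP => b0; have /eqP := b_free (fun l => (l == j)%:R) (etrans bj b0) j.
by rewrite eqxx oner_eq0.
Qed.

Lemma isotypic_basis_span v : exists c : index -> D^c, v = \sum_p c p *: isotypic_basis p.
Proof.
have [r [_ _ ->]] := componentP dV v; elim/big_rec: _ => [|h x _ [c ->]].
  by exists (fun=> 0); rewrite big1 // => p _; rewrite scale0r.
suff [d ->] : exists d : index -> D^c, component dV h v = \sum_p d p *: isotypic_basis p.
  exists (fun p => d p + c p).
  by rewrite -big_split; apply: eq_bigr => p _; rewrite scalerDl.
have [->|u0] := eqVneq (component dV h v) 0.
  by exists (fun=> 0); rewrite big1 // => p _; rewrite scale0r.
have Vu := component_in dV h v; have [i gi] := isotypic_cover Vu u0.
have : isotypic D_ V_ (g i) (component dV h v) by apply: sum_over1 Vu.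
have [_ -> _] := isotypic_basisP i => -[c' ->].
(* The coefficients [c'], extended by zero to the basis vectors of the other components. *)
pose d (p : index) : D^c := untag 0 c' p; exists d.
have dE i' (j : 'I_(k i')) : d (idx j) = untag 0 c' (idx j) by [].
transitivity (\sum_i' \sum_(j < k i') d (idx j) *: isotypic_basis (idx j)).
  rewrite (bigD1 i) //= [X in _ + X]big1 ?addr0 => [|i' i'i].
    by apply: eq_bigr => j _; rewrite dE untagE.
  by apply: big1 => j _; rewrite dE untag_dflt ?scale0r.
rewrite (sig_big_dep _ _ (fun i j => d (idx j) *: isotypic_basis (idx j))).
by apply: eq_bigr => -[].
Qed.

(** The partial sums over the isotypic components have degrees in disjoint cosets, so each of them
    vanishes separately. *)
Lemma isotypic_basis_free (c : index -> D^c) :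
  \sum_p c p *: isotypic_basis p = 0 -> forall p, c p = 0.
Proof.
pose x i := \sum_(j < k i) c (idx j) *: isotypic_basis (idx j).
move=> c0 [i j]; have [_ WE b_free] := isotypic_basisP i.
apply: (b_free (fun j => c (idx j))); rewrite -/(x i).
have Wx l : isotypic D_ V_ (g l) (x l).
  by have [_ -> _] := isotypic_basisP l; exists (fun j => c (idx j)).
have x0 : \sum_i x i = 0.
  rewrite -[RHS]c0 /x (sig_big_dep _ _ (fun i j => c (idx j) *: isotypic_basis (idx j))).
  by apply: eq_bigr => -[].
apply: (eq_component (dC := dV)) => h; rewrite component0.
have [gi|gi] := pselect (coset T (g i) h); last exact: component_notin (Wx i) gi.
have := congr1 (component dV h) x0.
rewrite component0 component_sum (bigD1 i) //= big1 ?addr0 // => l li.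
apply: component_notin (Wx l) _ => gl.
by rewrite (coset_index_inj gi gl) eqxx in li.
Qed.

Definition isotypic_basis_degree p := s2val (cid2 (isotypic_basis_deg p)).

Lemma isotypic_basis_degreeP p : V_ (isotypic_basis_degree p) (isotypic_basis p).
Proof. by rewrite /isotypic_basis_degree; case: cid2. Qed.

Lemma isotypic_basis_degree_coset p : coset T (g (tag p)) (isotypic_basis_degree p).
Proof. by rewrite /isotypic_basis_degree; case: cid2. Qed.

(** Separation with (r, l) = (p, p) forbids two basis vectors in one component, whence k_i = 1.
    Basis vectors then correspond to components, and the two conditions agree modulo T. *)
Lemma separated_fine_condition :
  separated D_ isotypic_basis_degree <-> fine_condition T g k.
Proof.
(* Each basis degree differs from its coset representative by an element of T, so one may replace
   the other modulo T. *)
have shift p q r l : T ((isotypic_basis_degree p - isotypic_basis_degree q) -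
    (isotypic_basis_degree r - isotypic_basis_degree l)) <->
  T ((g (tag p) - g (tag q)) - (g (tag r) - g (tag l))).
  pose u p := isotypic_basis_degree p - g (tag p).
  apply: gsupp_congr.
  have -> : (isotypic_basis_degree p - isotypic_basis_degree q) -
      (isotypic_basis_degree r - isotypic_basis_degree l) -
      ((g (tag p) - g (tag q)) - (g (tag r) - g (tag l))) = (u p - u q) - (u r - u l).
    by rewrite subrACA; congr (_ - _); rewrite subrACA.
  have Tu p' : T (u p') by apply: isotypic_basis_degree_coset.
  by apply: (gsuppB D_div); apply: (gsuppB D_div).
split=> [sep|[k1 gsep] p q r l pq pqrl Tw].
  split=> [i|i j h l ij ijhl].
    apply/eqP; rewrite eqn_leq isotypic_dim_gt0 andbT leqNgt; apply/negP => ki.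
    pose p : index := idx (Ordinal (isotypic_dim_gt0 i)).
    pose q : index := idx (Ordinal ki).
    have pq : p <> q by move=> /eqP; rewrite eq_Tagged.
    apply: (sep p q p p pq); first by move=> -[/esym].
    by apply/shift; rewrite /= !subrr; apply: gsupp0.
  pose o i : index := idx (Ordinal (isotypic_dim_gt0 i)).
  have oinj i' j' : o i' = o j' -> i' = j' by move=> /(congr1 tag).
  move=> Tg; apply: (sep (o i) (o j) (o h) (o l)); last exact/shift.
    by move/oinj.
  by case=> ? ?; apply: ijhl; congr (_, _).
have k_ord i (a : 'I_(k i)) : a = 0%N :> nat.
  by have := ltn_ord a; rewrite [X in (_ < X)%N]k1 ltnS leqn0 => /eqP.
have tag_inj (p' q' : index) : tag p' = tag q' -> p' = q'.
  case: p' q' => [i' a] [j' b] /= e; rewrite -e in b *.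
  by congr (Tagged _ _); apply: val_inj; rewrite /= !k_ord.
apply: (gsep (tag p) (tag q) (tag r) (tag l) _ _ ((shift p q r l).1 Tw)).
  by move/tag_inj.
by case=> /tag_inj pr /tag_inj ql; apply: pqrl; rewrite pr ql.
Qed.

End Isotypic.

Theorem theorem8 (G : zmodType) (F : fieldType)
    (R : lmodType F) (mul : R -> R -> R) (R_ : G -> set R)
    (R_alg : assoc_algebra mul) (R_grading : grading mul R_)
    (R_simple : graded_simple mul R_) (R_dcc : graded_left_dcc mul R_)
    (D : algType F) (D_ : G -> set D) (D_div : graded_division D_)
    (V : lmodType D^c) (V_ : G -> set V) (V_graded : graded_module D_ V_)
    (V_neq0 : exists v : V, v != 0)
    (V_findim : exists n, has_dim V_ [set: V] n)
    (phi : R -> {linear V -> V}) (R_iso : graded_iso_End V_ mul R_ phi)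
    (s : nat) (g : 'I_s -> G) (k : 'I_s -> nat)
    (g_distinct : injective (fun i => coset (gsupp D_) (g i)))
    (g_supports : [set graded_supp V_ W | W in isotypic_components D_ V_] =
                  range (fun i => coset (gsupp D_) (g i)))
    (k_dim : forall i, has_dim V_ (isotypic D_ V_ (g i)) (k i)) :
  fine mul R_ <->
  (fine_condition (gsupp D_) g k /\ fine *%R D_).
Proof.
(* As V is nonzero, some isotypic component exists; it supplies the basis index [p] that
   [fine_basis] asks for. *)
have [v v0] := V_neq0.
have [h /(isotypic_cover D_div g_supports (component_in _ h v))[i _]] :=
  component_neq0 (graded_module_direct_sum V_graded) v0.
pose p : {i : 'I_s & 'I_(k i)} :=
  Tagged _ (Ordinal (isotypic_dim_gt0 D_div g_supports k_dim i)).
rewrite -(separated_fine_condition D_div V_graded g_supports k_dim).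
apply: (fine_basis D_div V_graded _ _ _ p R_grading R_iso).
- exact: isotypic_basis_degreeP.
- exact: isotypic_basis_span.
- exact: isotypic_basis_free.
Qed.
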